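(* Let $X\in\mathcal S^n$, $y\in\mathbb R^m$, $S\in\mathcal S^n$, $\eta>1$, and put $\bar C=C-\sum_{i=1}^my_iA_i-S$ and $\bar b_i=b_i-A_i\bullet X$ for $i=1,\dots,m$. Consider the refining problem $$(\bar P)\quad\min_{\bar X\in\mathcal S^n}\left\{\eta(\bar C+S)\bullet\bar X:\ A_i\bullet\bar X=\eta\bar b_i\ (i=1,\dots,m),\ \bar X\succeq-\eta X\right\}$$ and its dual, written in the variable $\bar S$ (the dual slack $S'$ shifted by $\bar S=S'-\eta S$), $$(\bar D)\quad\max_{(\bar y,\bar S)\in\mathbb R^m\times\mathcal S^n}\left\{\eta\bar b^\top\bar y-\eta X\bullet(\bar S+\eta S):\ \sum_{i=1}^m\bar y_iA_i+\bar S=\eta\bar C,\ \bar S\succeq-\eta S\right\}.$$ If $(\bar X,\bar y,\bar S)$ is an $\epsilon$-precise solution of the refining problem, then $\left(X+\frac1\eta\bar X,\ y+\frac1\eta\bar y,\ S+\frac1\eta\bar S\right)$ is an $\frac\epsilon\eta$-precise solution of the original SDO problem.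
   Context: $\mathcal S^n$ is the space of real symmetric $n\times n$ matrices, $U\bullet V=\mathrm{tr}(UV)$, $\succeq$ is the Löwner order. The original SDO problem, with data $b\in\mathbb R^m$, $C,A_1,\dots,A_m\in\mathcal S^n$ ($A_i$ linearly independent), is the pair $\inf_X\{C\bullet X:A_i\bullet X=b_i\ (i\le m),X\succeq0\}$ and $\sup_{y,S}\{b^\top y:\sum_iy_iA_i+S=C,S\succeq0\}$; strong duality (zero duality gap) is assumed to hold. $\epsilon>0$, and $\|\cdot\|$ denotes a fixed norm on $\mathcal S^n$, respectively on $\mathbb R^m$. For the original problem, $(X,y,S)\in\mathcal S^n\times\mathbb R^m\times\mathcal S^n$ is $\epsilon$-precise if $X\succeq0$, $S\succeq0$, $\|C-\sum_iy_iA_i-S\|\le\epsilon$, $\|(b_i-A_i\bullet X)_{i=1}^m\|\le\epsilon$ and $X\bullet S\le\epsilon$. Correspondingly, $(\bar X,\bar y,\bar S)$ is $\epsilon$-precise for the refining problem if $\bar X+\eta X\succeq0$, $\bar S+\eta S\succeq0$, $\|\eta\bar C-\sum_i\bar y_iA_i-\bar S\|\le\epsilon$, $\|(\eta\bar b_i-A_i\bullet\bar X)_{i=1}^m\|\le\epsilon$ and $(\bar X+\eta X)\bullet(\bar S+\eta S)\le\epsilon$. *)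

(* Defs.v *)
From mathcomp Require Import all_boot all_order all_algebra.
From mathcomp Require Import classical_sets reals ereal.
From mathcomp Require Import ring.

Set Implicit Arguments.
Unset Strict Implicit.
Unset Printing Implicit Defensive.

Import Order.TTheory GRing.Theory Num.Theory.

Local Open Scope ring_scope.
Local Open Scope classical_set_scope.

Section SymmetricMatrices.
Variable R : realType.

(* [Sym R n] is a library subspace type, so it carries the [vectType]
   structure induced by ['M[R]_n]. *)
Definition sym_space (n : nat) : {vspace 'M[R]_n} :=
  fixedSpace (linfun (@trmx R n n)).

Definition Sym (n : nat) := subvs_of (sym_space n).

Lemma mem_sym_space n (U : 'M[R]_n) : (U \in sym_space n) = (U^T == U).
Proof. by apply/fixedSpaceP/eqP; rewrite lfunE. Qed.

Definition frob n (U V : Sym n) : R := \tr (vsval U *m vsval V).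

Definition psd n (U : Sym n) : Prop :=
  forall v : 'cV[R]_n, 0 <= (v^T *m vsval U *m v) 0 0.

Definition loewner_le n (U V : Sym n) : Prop := psd (V - U).

Record is_norm (V : lmodType R) (N : V -> R) : Prop := IsNorm {
  norm_triangle : forall u v, N (u + v) <= N u + N v;
  norm_scale : forall a v, N (a *: v) = `|a| * N v;
  norm_eq0 : forall v, N v = 0 -> v = 0 }.

End SymmetricMatrices.

Section Problems.
Variables (R : realType) (m n : nat).
Implicit Types (C X S : Sym R n) (A : 'I_m -> Sym R n) (b y : 'cV[R]_m).

Definition lincomb A y : Sym R n := \sum_(i < m) y i 0 *: A i.
Definition frobs A X : 'cV[R]_m := \col_(i < m) frob (A i) X.
Definition dotp b y : R := (b^T *m y) 0 0.

Definition primal_feasible A b X : Prop :=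
  (forall i, frob (A i) X = b i 0) /\ psd X.

Definition dual_feasible C A y S : Prop := lincomb A y + S = C /\ psd S.

Definition primal_value C A b : \bar R :=
  ereal_inf [set (frob C X)%:E | X in [set X | primal_feasible A b X]].

Definition dual_value C A b : \bar R :=
  ereal_sup [set (dotp b p.1)%:E |
    p in [set p : 'cV[R]_m * Sym R n | dual_feasible C A p.1 p.2]].

Definition strong_duality C A b : Prop := primal_value C A b = dual_value C A b.

Definition eps_precise (normS : Sym R n -> R) (normV : 'cV[R]_m -> R)
    C A b (eps : R) X y S : Prop :=
  [/\ psd X, psd S,
      normS (C - lincomb A y - S) <= eps,
      normV (b - frobs A X) <= eps
    & frob X S <= eps].

Definition Cbar C A y S : Sym R n := C - lincomb A y - S.
Definition bbar A b X : 'cV[R]_m := b - frobs A X.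

Definition refP_feasible A b X (eta : R) (Xb : Sym R n) : Prop :=
  (forall i, frob (A i) Xb = eta * bbar A b X i 0)
  /\ loewner_le (- (eta *: X)) Xb.

Definition refP_obj C A y S (eta : R) (Xb : Sym R n) : R :=
  frob (eta *: (Cbar C A y S + S)) Xb.

Definition refD_feasible C A y S (eta : R) (yb : 'cV[R]_m) (Sb : Sym R n) :
    Prop :=
  lincomb A yb + Sb = eta *: Cbar C A y S /\ loewner_le (- (eta *: S)) Sb.

Definition refD_obj A b X S (eta : R) (yb : 'cV[R]_m) (Sb : Sym R n) : R :=
  eta * dotp (bbar A b X) yb - eta * frob X (Sb + eta *: S).

(* The complementarity term is the duality gap of the refining pair at
   feasible points, see [refining_gap] and [refining_precise0]. *)
Definition refining_precise (normS : Sym R n -> R) (normV : 'cV[R]_m -> R)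
    C A b X y S (eta eps : R) (Xb : Sym R n) (yb : 'cV[R]_m) (Sb : Sym R n) :
    Prop :=
  [/\ psd (Xb + eta *: X), psd (Sb + eta *: S),
      normS (eta *: Cbar C A y S - lincomb A yb - Sb) <= eps,
      normV (eta *: bbar A b X - frobs A Xb) <= eps
    & frob (Xb + eta *: X) (Sb + eta *: S) <= eps].

Lemma frobC (U V : Sym R n) : frob U V = frob V U.
Proof. exact: mxtrace_mulC. Qed.

Lemma frobDl (U V W : Sym R n) : frob (U + V) W = frob U W + frob V W.
Proof. by rewrite /frob linearD mulmxDl mxtraceD. Qed.

Lemma frobZl (a : R) (U V : Sym R n) : frob (a *: U) V = a * frob U V.
Proof. by rewrite /frob linearZ /= -scalemxAl mxtraceZ. Qed.

Lemma frobDr (U V W : Sym R n) : frob U (V + W) = frob U V + frob U W.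
Proof. by rewrite frobC frobDl !(frobC _ U). Qed.

Lemma frobZr (a : R) (U V : Sym R n) : frob U (a *: V) = a * frob U V.
Proof. by rewrite frobC frobZl frobC. Qed.

Lemma frob_lincomb A y U : frob (lincomb A y) U = dotp (frobs A U) y.
Proof.
rewrite /lincomb /dotp mxE.
have f0 : frob 0 U = 0 by rewrite -(scale0r U) frobZl mul0r.
rewrite (big_morph (fun V => frob V U) (fun V W => frobDl V W U) f0).
by apply: eq_bigr => i _; rewrite frobZl !mxE mulrC.
Qed.

Lemma refining_gap C A b X y S eta Xb yb Sb :
  refP_feasible A b X eta Xb -> refD_feasible C A y S eta yb Sb ->
  refP_obj C A y S eta Xb - refD_obj A b X S eta yb Sb
  = frob (Xb + eta *: X) (Sb + eta *: S).
Proof.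
move=> [HP _] [HD _]; rewrite /refP_obj /refD_obj scalerDr -HD.
have -> : eta * dotp (bbar A b X) yb = frob (lincomb A yb) Xb.
  rewrite frob_lincomb /dotp !mxE mulr_sumr; apply: eq_bigr => i _.
  by rewrite [in RHS]mxE [in RHS]mxE HP mulrA [in LHS]mxE.
rewrite !frobDl !frobDr !frobZl !frobZr !(frobC _ Xb).
by ring.
Qed.

Lemma refining_precise0 normS normV C A b X y S eta Xb yb Sb :
  is_norm normS -> is_norm normV ->
  refining_precise normS normV C A b X y S eta 0 Xb yb Sb <->
  [/\ refP_feasible A b X eta Xb, refD_feasible C A y S eta yb Sb
    & refP_obj C A y S eta Xb <= refD_obj A b X S eta yb Sb].
Proof.
move=> HS HV.
have N0 (V : lmodType R) (N : V -> R) u : is_norm N -> N u <= 0 <-> u = 0.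
  move=> HN; have N00 : N 0 = 0.
    by rewrite -(scale0r 0) (norm_scale HN) normr0 mul0r.
  split=> [u0|->]; last by rewrite N00.
  apply: (norm_eq0 HN); apply/eqP; rewrite eq_le u0 /=.
  have := norm_triangle HN u (- u).
  rewrite subrr N00 -scaleN1r (norm_scale HN) normrN1 mul1r => ?.
  by rewrite -(pmulrn_lge0 _ (ltn0Sn 1)) mulr2n.
have eP : refP_feasible A b X eta Xb <->
    psd (Xb + eta *: X) /\ eta *: bbar A b X - frobs A Xb = 0.
  rewrite /refP_feasible /loewner_le opprK; split=> -[H1 H2]; split=> //.
    by apply/colP => i; have := H1 i; rewrite !mxE => ->; rewrite subrr.
  move=> i; apply/eqP; rewrite eq_sym -subr_eq0; apply/eqP.
  by have /colP/(_ i) := H2; rewrite !mxE.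
have eD : refD_feasible C A y S eta yb Sb <->
    psd (Sb + eta *: S) /\ eta *: Cbar C A y S - lincomb A yb - Sb = 0.
  rewrite /refD_feasible /loewner_le opprK; split=> -[H1 H2]; split=> //.
    by rewrite -H1 -addrA -opprD subrr.
  by apply/esym/eqP; rewrite -subr_eq0 opprD addrA H2.
split.
  case=> H1 H2 /(N0 _ _ _ HS) H3 /(N0 _ _ _ HV) H4 H5.
  have fP : refP_feasible A b X eta Xb by apply/eP.
  have fD : refD_feasible C A y S eta yb Sb by apply/eD.
  by split=> //; rewrite -subr_le0 (refining_gap fP fD).
case=> fP fD; rewrite -subr_le0 (refining_gap fP fD) => H5.
have [H1 H4] := eP.1 fP; have [H2 H3] := eD.1 fD.
by split=> //; [apply/(N0 _ _ _ HS) | apply/(N0 _ _ _ HV)].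
Qed.

End Problems.

(* Main.v *)
Require Import Defs.
From mathcomp Require Import all_boot all_order all_algebra.
From mathcomp Require Import classical_sets reals ereal.

Import Order.TTheory GRing.Theory Num.Theory.
Local Open Scope ring_scope.

(** The refining problem is the original problem translated by the current
    iterate and magnified by [eta]: the refined triple is the iterate plus
    [eta^-1] times the refining triple.  Consequently each ingredient of the
    precision of the refined triple is a power of [eta^-1] times the
    corresponding ingredient for the refining triple:
    - the refined [X] and [S] are [eta^-1] times the matrices [Xb + eta *: X]
      and [Sb + eta *: S], and the semidefinite cone is stable under
      nonnegative scaling ([psdZ]);
    - the residuals are affine, so they are [eta^-1] times the refining
      residuals ([dual_residual_refine], [primal_residual_refine]), and norms
      are homogeneous;
    - complementarity is bilinear, so it is even multiplied by [eta^-2], which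
      is at most [eta^-1] because [1 < eta]. *)

Lemma psdZ (R : realType) (n : nat) (a : R) (U : Sym R n) :
  0 <= a -> psd U -> psd (a *: U).
Proof.
move=> a0 Upsd v.
have -> : vsval (a *: U) = a *: vsval U by rewrite linearZ.
by rewrite -scalemxAr -scalemxAl mxE mulr_ge0 // Upsd.
Qed.

(** Turns a component of the refined triple into a multiple of a shifted
    component of the refining triple, the form to which homogeneity applies. *)
Lemma unscale_shift (R : fieldType) (V : lmodType R) (a : R) (u v : V) :
  a != 0 -> v + a^-1 *: u = a^-1 *: (u + a *: v).
Proof. by move=> a0; rewrite scalerDr scalerA mulVf // scale1r addrC. Qed.

Lemma norm_scaleV_le (R : realType) (V : lmodType R) (N : V -> R)
    (a e : R) (u : V) :
  is_norm N -> 0 < a -> N u <= e -> N (a^-1 *: u) <= e / a.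
Proof.
move=> HN a0 ue.
by rewrite (norm_scale HN) gtr0_norm ?invr_gt0 // mulrC ler_pM2r ?invr_gt0.
Qed.

Lemma lincombDZ (R : realType) (m n : nat) (A : 'I_m -> Sym R n) (a : R)
    (y z : 'cV[R]_m) :
  lincomb A (y + a *: z) = lincomb A y + a *: lincomb A z.
Proof.
rewrite /lincomb scaler_sumr -big_split /=; apply: eq_bigr => i _.
by rewrite !mxE scalerDl scalerA.
Qed.

Lemma frobsDZ (R : realType) (m n : nat) (A : 'I_m -> Sym R n) (a : R)
    (X Y : Sym R n) :
  frobs A (X + a *: Y) = frobs A X + a *: frobs A Y.
Proof. by apply/colP => i; rewrite !mxE frobDr frobZr. Qed.

(** Subtracting [lincomb A (a^-1 *: yb) + a^-1 *: Sb] from the current residual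
    [Cbar C A y S] gives the refined one; scaling [Cbar] by [a] in the refining
    problem is what makes the correction commensurate. *)
Lemma dual_residual_refine (R : realType) (m n : nat) (C : Sym R n)
    (A : 'I_m -> Sym R n) (y yb : 'cV[R]_m) (S Sb : Sym R n) (a : R) :
  a != 0 ->
  C - lincomb A (y + a^-1 *: yb) - (S + a^-1 *: Sb)
  = a^-1 *: (a *: Cbar C A y S - lincomb A yb - Sb).
Proof.
move=> a0; rewrite lincombDZ 2!scalerBr scalerA mulVf // scale1r /Cbar.
by rewrite !opprD !addrA; congr (_ - _); rewrite addrAC.
Qed.

Lemma primal_residual_refine (R : realType) (m n : nat)
    (A : 'I_m -> Sym R n) (b : 'cV[R]_m) (X Xb : Sym R n) (a : R) :
  a != 0 ->
  b - frobs A (X + a^-1 *: Xb)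
  = a^-1 *: (a *: bbar A b X - frobs A Xb).
Proof.
move=> a0; rewrite frobsDZ scalerBr scalerA mulVf // scale1r /bbar.
by rewrite opprD addrA.
Qed.

Theorem theorem9 (R : realType) (m n : nat)
    (C : Sym R n) (A : 'I_m -> Sym R n) (b : 'cV[R]_m)
    (normS : Sym R n -> R) (normV : 'cV[R]_m -> R) (eps eta : R)
    (X : Sym R n) (y : 'cV[R]_m) (S : Sym R n)
    (Xb : Sym R n) (yb : 'cV[R]_m) (Sb : Sym R n)
    (hA : free (codom A))
    (hsd : strong_duality C A b)
    (hnormS : is_norm normS) (hnormV : is_norm normV)
    (heps : 0 < eps) (heta : 1 < eta)
    (hprec : refining_precise normS normV C A b X y S eta eps Xb yb Sb) :
  eps_precise normS normV C A b (eps / eta)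
    (X + eta^-1 *: Xb) (y + eta^-1 *: yb) (S + eta^-1 *: Sb).
Proof.
have eta0 : 0 < eta by apply: lt_trans heta.
have etaN0 : eta != 0 by rewrite gt_eqF.
have etaV0 : 0 < eta^-1 by rewrite invr_gt0.
case: hprec => psdX psdS resD resP compl; split.
- by rewrite (unscale_shift _ _ _ _ _ etaN0); apply: psdZ => //; apply: ltW.
- by rewrite (unscale_shift _ _ _ _ _ etaN0); apply: psdZ => //; apply: ltW.
- by rewrite dual_residual_refine //; apply: norm_scaleV_le.
- by rewrite primal_residual_refine //; apply: norm_scaleV_le.
- rewrite !(unscale_shift _ _ _ _ _ etaN0) frobZl frobZr mulrC.
  rewrite ler_pM2r //.
  (* The second factor [eta^-1] only has to be bounded by [1]. *)
  apply: (@le_trans _ _ (eta^-1 * eps)); first by rewrite ler_pM2l.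
  by rewrite ler_piMl ?(ltW heps) // invf_le1 // ltW.
Qed.
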